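(* The relation $\sim_I$ on $\mathbb{T}$ (where $A \sim_I B$ iff $I(A,\sigma) = I(B,\sigma)$ for every environment $\sigma$) is a prelambda congruence.
   Context: Let $\mathbb{V}$ be an infinite set whose elements are called variables. The set $\mathbb{T}$ of terms is the set of words inductively defined by: every variable $x$ is a term; if $A,B$ are terms then $[AB]$ is a term; if $x$ is a variable and $A$ a term then $[\lambda x A]$ is a term. Equality of terms is syntactic identity. We abbreviate $[AB]$ as $AB$ and $[\lambda x A]$ as $\lambda x A$. A binary relation $\sim$ on $\mathbb{T}$ is a congruence if it is reflexive, symmetric, transitive, and for all terms $A,B,C,D$ and every variable $x$: $A\sim B$ implies $\lambda x A \sim \lambda x B$, and $A\sim B$, $C \sim D$ imply $AC \sim BD$. A prelambda congruence is a congruence $\sim$ such that for all terms $A,B,D$ and all variables $x,y$: ($\beta_1$) $[\lambda x x]D \sim D$; ($\beta_2$) $[\lambda x y]D \sim y$ whenever $x\neq y$; ($\beta_3$) $[\lambda x[AB]]D \sim [[\lambda x A]D][[\lambda x B]D]$; ($\beta_4$) $[\lambda x[\lambda x A]]D \sim \lambda x A$; ($\beta_5$) if $x \neq y$ and $[\lambda y D]x \sim D$, then $[\lambda x[\lambda y A]]D \sim \lambda y[[\lambda x A]D]$. The set $\mathfrak{F}$ of formulas is inductively defined by: every variable is a formula (an atomic formula); if $F$ is a finite subset of $\mathfrak{F}$ and $\ell \in \mathfrak{F}$, then the ordered pair $(F,\ell)$, written $F \vdash \ell$, is a formula (a compound formula; compound formulas are distinct from variables). An environment is a function $\sigma$ from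 $\mathbb{V}$ to the set of finite subsets of $\mathfrak{F}$. For an environment $\sigma$, a variable $x$ and a finite $F \subseteq \mathfrak{F}$, the update $\{F/x\}\sigma$ is the environment mapping $x$ to $F$ and every $y \neq x$ to $\sigma(y)$. The interpretation $I(A,\sigma) \subseteq \mathfrak{F}$ of a term $A$ in environment $\sigma$ is defined by induction on $A$: $I(x,\sigma) = \sigma(x)$; $I(AB,\sigma) = \{\ell : \text{there is a finite } F \subseteq I(B,\sigma) \text{ with } F\vdash \ell \in I(A,\sigma)\}$; $I(\lambda x A,\sigma) = \{F\vdash m : F \subseteq \mathfrak{F} \text{ finite}, m \in I(A,\{F/x\}\sigma)\} \cup \{x\}$. *)

(* Defs.v *)
From HB Require Import structures.
From Stdlib Require List.
From mathcomp Require Import all_boot finmap.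
From mathcomp Require Export boolp classical_sets functions cardinality.

Set Implicit Arguments.
Unset Strict Implicit.
Unset Printing Implicit Defensive.

Local Open Scope fset_scope.
Local Open Scope classical_set_scope.

Inductive term (V : Type) : Type :=
| Var of V
| App of term V & term V
| Lam of V & term V.

Arguments Var {V} _.
Arguments App {V} _ _.
Arguments Lam {V} _ _.

Record congruence (V : Type) (R : term V -> term V -> Prop) : Prop := {
  congr_refl : forall A, R A A;
  congr_sym : forall A B, R A B -> R B A;
  congr_trans : forall A B C, R A B -> R B C -> R A C;
  congr_lam : forall x A B, R A B -> R (Lam x A) (Lam x B);
  congr_app : forall A B C D, R A B -> R C D -> R (App A C) (App B D)
}.

Record prelambda_congruence (V : Type) (R : term V -> term V -> Prop) : Prop := {
  prelambda_congr : congruence R;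
  prelambda_beta1 : forall (x : V) (D : term V), R (App (Lam x (Var x)) D) D;
  prelambda_beta2 : forall (x y : V) (D : term V), x <> y ->
    R (App (Lam x (Var y)) D) (Var y);
  prelambda_beta3 : forall (x : V) (A B D : term V),
    R (App (Lam x (App A B)) D) (App (App (Lam x A) D) (App (Lam x B) D));
  prelambda_beta4 : forall (x : V) (A D : term V),
    R (App (Lam x (Lam x A)) D) (Lam x A);
  prelambda_beta5 : forall (x y : V) (A D : term V), x <> y ->
    R (App (Lam y D) (Var x)) D ->
    R (App (Lam x (Lam y A)) D) (Lam y (App (Lam x A) D))
}.

(* A direct inductive definition of formulas with a constructor taking a
   finite set [{fset formula}] is not accepted: [{fset K}] needs a choice
   structure on [K].  So formulas are trees built with lists in which every
   list is the canonical enumeration of a finite set in the sense of finmap;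
   there is exactly one such tree per formula. The lemmas [atom_inj],
   [compound_inj], [atom_neq_compound] and [formula_ind] below show that
   [formula V] is freely generated by [atom] and [compound]. *)
Inductive tree (V : Type) : Type :=
| Leaf of V
| Node of seq (tree V) & tree V.

Arguments Leaf {V} _.
Arguments Node {V} _ _.

Fixpoint tree_all (V : Type) (P : tree V -> Prop)
    (HL : forall x, P (Leaf x))
    (HN : forall s t, List.Forall P s -> P t -> P (Node s t)) (t : tree V) : P t :=
  match t with
  | Leaf x => HL x
  | Node s u =>
    HN s u
      ((fix loop (s : seq (tree V)) : List.Forall P s :=
          match s with
          | [::] => List.Forall_nil P
          | v :: s' => List.Forall_cons v (tree_all HL HN v) (loop s')
          end) s)
      (tree_all HL HN u)
  end.

Fixpoint tree_encode (V : Type) (t : tree V) : GenTree.tree V :=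
  match t with
  | Leaf x => GenTree.Leaf x
  | Node s u => GenTree.Node 0 (tree_encode u :: map (@tree_encode V) s)
  end.

Fixpoint tree_decode (V : Type) (t : GenTree.tree V) : option (tree V) :=
  match t with
  | GenTree.Leaf x => Some (Leaf x)
  | GenTree.Node _ (u :: s) =>
    omap (Node (pmap (@tree_decode V) s)) (tree_decode u)
  | GenTree.Node _ [::] => None
  end.

Lemma tree_encodeK (V : Type) : pcancel (@tree_encode V) (@tree_decode V).
Proof.
elim/tree_all => [x|s t IHs IHt] //=; rewrite IHt /=; congr (Some (Node _ _)).
by elim: IHs => //= u s' Hu _ IH; rewrite Hu /= IH.
Qed.

HB.instance Definition _ (V : eqType) :=
  Equality.copy (tree V) (pcan_type (@tree_encodeK V)).
HB.instance Definition _ (V : choiceType) :=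
  Choice.copy (tree V) (pcan_type (@tree_encodeK V)).

Fixpoint canonical_tree (V : choiceType) (t : tree V) : bool :=
  match t with
  | Leaf _ => true
  | Node s u => [&& canonical_keys s, all (@canonical_tree V) s & canonical_tree u]
  end.

Record formula (V : choiceType) : Type :=
  Formula { formula_tree :> tree V; _ : canonical_tree formula_tree }.

HB.instance Definition _ (V : choiceType) :=
  [isSub for @formula_tree V].
HB.instance Definition _ (V : choiceType) :=
  [Choice of formula V by <:].

Definition atom (V : choiceType) (x : V) : formula V :=
  @Formula V (Leaf x) isT.

Lemma compound_subproof (V : choiceType) (F : {fset formula V}) (l : formula V) :
  canonical_tree
    (Node (sort_keys [seq formula_tree f | f <- enum_fset F]) (formula_tree l)).
Proof.
rewrite /= canonical_sort_keys (valP l) andbT /=.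
by apply/allP => t /mem_sort_keys_intro /mapP[f _ ->]; exact: (valP f).
Qed.

(* The ordered pair [F |- l]. *)
Definition compound (V : choiceType) (F : {fset formula V}) (l : formula V) :
  formula V := Formula (compound_subproof F l).

Lemma atom_inj (V : choiceType) : injective (@atom V).
Proof. by move=> x y []. Qed.

Lemma atom_neq_compound (V : choiceType) (x : V) (F : {fset formula V})
  (l : formula V) : atom x <> compound F l.
Proof. by []. Qed.

Lemma compound_inj (V : choiceType) (F G : {fset formula V}) (l m : formula V) :
  compound F l = compound G m -> F = G /\ l = m.
Proof.
move=> [/eq_sort_keys eqFG /val_inj ->]; split=> //.
apply/fsetP => f; rewrite -[f \in F](mem_map (@val_inj _ _ (formula V))).
by rewrite eqFG (mem_map (@val_inj _ _ (formula V))).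
Qed.

Lemma formula_ind (V : choiceType) (P : formula V -> Prop) :
  (forall x, P (atom x)) ->
  (forall (F : {fset formula V}) l,
     (forall f, f \in F -> P f) -> P l -> P (compound F l)) ->
  forall f, P f.
Proof.
move=> HA HC [t]; elim/tree_all: t => [x|s u IHs IHu] i.
  by rewrite (_ : Formula i = atom x) //; exact: val_inj.
have /and3P[cs /allP als cu] := i.
have {}IHs t (ts : t \in s) (it : canonical_tree t) : P (Formula it).
  apply: (proj1 (List.Forall_forall _ _) IHs t).
  elim: (s) ts => //= v s' IH; rewrite inE.
  by case/predU1P => [->|/IH]; [left|right].
pose F := [fset f in pmap (insub : tree V -> option (formula V)) s].
have inF f : (f \in F) = (val f \in s) by rewrite inE /= mem_pmap_sub.
rewrite (_ : Formula i = compound F (Formula cu)).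
  by apply: HC; [move=> [t it]; rewrite inF => /IHs; apply | exact: IHu].
apply: val_inj => /=; congr Node; rewrite -(eqP cs); apply/eq_sort_keys => t.
apply/idP/mapP => [ts|[f]]; last by rewrite inF => ? ->.
by exists (Formula (als t ts)); rewrite ?inF.
Qed.

Definition environment (V : choiceType) : Type := V -> {fset formula V}.

Definition update (V : choiceType) (F : {fset formula V}) (x : V)
  (sigma : environment V) : environment V :=
  fun y => if y == x then F else sigma y.

Fixpoint interp (V : choiceType) (A : term V) (sigma : environment V) :
    set (formula V) :=
  match A with
  | Var x => [set` sigma x]
  | App A B =>
    [set l | exists F : {fset formula V},
       [set` F] `<=` interp B sigma /\ interp A sigma (compound F l)]
  | Lam x A =>
    [set f | exists (F : {fset formula V}) (m : formula V),
       interp A (update F x sigma) m /\ f = compound F m] `|` [set atom x]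
  end.

Definition interp_equiv (V : choiceType) (A B : term V) : Prop :=
  forall sigma : environment V, interp A sigma = interp B sigma.

(* Main.v *)
(** Unfolding [interp], every application of an abstraction becomes an
    evaluation of the body in an updated environment: [l] lies in the
    interpretation of [[\x A]D] iff [l] lies in that of [A] after updating [x]
    to some finite [F] contained in the interpretation of [D].  As [interp] is
    monotone in the environment, the finitely many sets [F] needed for beta3 can
    be merged into their union.  For beta5, monotonicity identifies the
    interpretation of [[\y D]x] with that of [D] after updating [y] to
    [sigma x]; the hypothesis then says that the value of [y] does not matter
    for [D], since [sigma x] itself is unaffected by updates of [y]. *)
Require Import Defs.
From mathcomp Require Import all_boot.
From mathcomp Require finmap.
Local Open Scope classical_set_scope.

Section Interpretation.
Import finmap.
Local Open Scope fset_scope.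
Local Open Scope classical_set_scope.
Set Implicit Arguments.
Unset Strict Implicit.
(** Peel off one element of [G] at a time: its own witness is joined to the one found for the rest,
    and upward closure of [Q] keeps both usable. *)
Lemma directed_choice_fset (K T : choiceType) (P : {fset K} -> Prop)
    (Q : {fset K} -> T -> Prop) (G : {fset T}) :
  P fset0 -> (forall F F', P F -> P F' -> P (F `|` F')%fset) ->
  (forall F F' l, (F `<=` F')%fset -> Q F l -> Q F' l) ->
  (forall l, l \in G -> exists F, P F /\ Q F l) ->
  exists F, P F /\ forall l, l \in G -> Q F l.
Proof.
move=> P0 PU Qmono.
elim/finSet_rect: G => G IH HG.
have [->|[g gG]] := fset_0Vmem G; first by exists fset0.
have [|l|F [PF QF]] := IH (G `\ g)%fset; first exact: fproperD1.
  by rewrite in_fsetD1 => /andP[_ /HG].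
have [F' [PF' QF']] := HG g gG.
exists (F `|` F')%fset; split=> [|l lG]; first exact: PU.
have [->|lg] := eqVneq l g; first exact: Qmono (fsubsetUr _ _) QF'.
by apply: Qmono (fsubsetUl _ _) (QF l _); rewrite in_fsetD1 lg.
Qed.

Variable V : choiceType.
Implicit Types (x y : V) (A B D : term V) (sigma tau : environment V).
Implicit Types (F G : {fset formula V}) (l m : formula V).

Lemma interp_mono A sigma tau :
  (forall z, sigma z `<=` tau z)%fset -> interp A sigma `<=` interp A tau.
Proof.
elim: A sigma tau => [x|A IHA B IHB|x A IHA] sigma tau st l /=.
- exact: (fsubsetP (st x)).
- case=> F [FB FA]; exists F; split; last exact: IHA FA.
  by move=> f /FB; exact: IHB.
- case=> [[F [m [mA ->]]]|->]; last by right.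
  left; exists F, m; split=> //; apply: IHA mA => z.
  by rewrite /update; case: ifP.
Qed.

Lemma interp_update_mono A F G x sigma : (F `<=` G)%fset ->
  interp A (update F x sigma) `<=` interp A (update G x sigma).
Proof. by move=> FG; apply: interp_mono => z; rewrite /update; case: ifP. Qed.

Lemma update_same F G x sigma : update F x (update G x sigma) = update F x sigma.
Proof. by apply/funext => z; rewrite /update; case: eqP. Qed.

Lemma update_swap F G x y sigma : x <> y ->
  update F x (update G y sigma) = update G y (update F x sigma).
Proof.
move=> xy; apply/funext => z; rewrite /update.
by case: (z =P x) => [->|//]; case: eqP.
Qed.

(** The extra element [atom x] of an abstraction is never a compound, and [compound] is
    injective. *)
Lemma interp_lam_compound x A sigma F l :
  interp (Lam x A) sigma (compound F l) <-> interp A (update F x sigma) l.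
Proof.
split=> [[[G [m [mA /compound_inj[-> ->]]]]|/esym/atom_neq_compound]|lA] //.
by left; exists F, l.
Qed.

Lemma interp_betaE x A D sigma l : interp (App (Lam x A) D) sigma l ->
  exists F, [set` F] `<=` interp D sigma /\ interp A (update F x sigma) l.
Proof. by case=> F [FD /interp_lam_compound lA]; exists F. Qed.

Lemma interp_betaI F x A D sigma l :
  [set` F] `<=` interp D sigma -> interp A (update F x sigma) l ->
  interp (App (Lam x A) D) sigma l.
Proof. by move=> FD lA; exists F; split=> //; apply/interp_lam_compound. Qed.

(** Among the finite subsets of the interpretation of [Var x], [sigma x] is itself the largest, so
    by monotonicity it is the only argument to try. *)
Lemma interp_beta_var x y D sigma :
  interp (App (Lam y D) (Var x)) sigma = interp D (update (sigma x) y sigma).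
Proof.
apply/seteqP; split=> l.
  move=> /interp_betaE[F [Fx]]; apply: interp_update_mono.
  by apply/fsubsetP => f; exact: Fx.
by move=> lD; apply: (@interp_betaI (sigma x)).
Qed.

Lemma fset0_sub_interp A sigma : [set` fset0 : {fset formula V}] `<=` interp A sigma.
Proof. by move=> f /=; rewrite in_fset0. Qed.

Lemma interp_equiv_congruence : congruence (@interp_equiv V).
Proof.
split=> [//|A B AB sigma|A B C AB BC sigma|x A B AB sigma|A B C D AB CD sigma].
- by rewrite AB.
- by rewrite AB BC.
(* Equality of the functions is needed because the environment is updated under the binder of the
   comprehension. *)
- by have /funext AB' : interp A =1 interp B by []; rewrite /= AB'.
- by rewrite /= AB CD.
Qed.

Lemma interp_equiv_beta1 x D : interp_equiv (App (Lam x (Var x)) D) D.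
Proof.
move=> sigma; apply/seteqP; split=> l.
  by move=> /interp_betaE[F [FD]]; rewrite /= /update eqxx => /FD.
move=> lD; apply: (@interp_betaI [fset l]).
  by move=> f /=; rewrite in_fset1 => /eqP ->.
by rewrite /= /update eqxx in_fset1.
Qed.

Lemma interp_equiv_beta2 x y D : x <> y ->
  interp_equiv (App (Lam x (Var y)) D) (Var y).
Proof.
move=> xy sigma.
have yF F : update F x sigma y = sigma y.
  by rewrite /update; case: eqP => // /esym.
apply/seteqP; split=> l; first by move=> /interp_betaE[F [_]]; rewrite /= yF.
(* The empty set is an admissible argument even when [interp D sigma] is empty. *)
move=> ly; apply: (@interp_betaI fset0); last by rewrite /= yF.
exact: fset0_sub_interp.
Qed.

Lemma interp_equiv_beta3 x A B D :
  interp_equiv (App (Lam x (App A B)) D) (App (App (Lam x A) D) (App (Lam x B) D)).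
Proof.
move=> sigma; apply/seteqP; split=> l.
  move=> /interp_betaE[F [FD [G [GB GA]]]]; exists G; split; last first.
    by apply: (@interp_betaI F).
  by move=> g /GB gB; apply: (@interp_betaI F).
move=> [G [GB /interp_betaE[F [FD lA]]]].
have unionD F1 F2 : [set` F1] `<=` interp D sigma ->
    [set` F2] `<=` interp D sigma -> [set` (F1 `|` F2)%fset] `<=` interp D sigma.
  by move=> D1 D2 f /=; rewrite in_fsetU => /orP[/D1|/D2].
have [|||g /GB /interp_betaE //|F' [F'D F'B]] := @directed_choice_fset _ _
  (fun F => [set` F] `<=` interp D sigma)
  (fun F => interp B (update F x sigma)) G.
- exact: fset0_sub_interp.
- exact: unionD.
- by move=> F1 F2 m F12; exact: interp_update_mono.
(* [F] serves the function part and [F'] serves every element of [G] at once. *)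
apply: (@interp_betaI (F `|` F')%fset); first exact: unionD.
exists G; split; last exact: interp_update_mono (fsubsetUl _ _) _ lA.
by move=> g /F'B; apply: interp_update_mono; exact: fsubsetUr.
Qed.

(** The inner binder overwrites whatever the outer one assigned to [x]. *)
Lemma interp_equiv_beta4 x A D :
  interp_equiv (App (Lam x (Lam x A)) D) (Lam x A).
Proof.
have lamE F sigma : interp (Lam x A) (update F x sigma) = interp (Lam x A) sigma.
  rewrite /=; congr (_ `|` _); apply/seteqP.
  by split=> _ [G [m [mA ->]]]; exists G, m; move: mA; rewrite update_same.
move=> sigma; apply/seteqP; split=> l.
  by move=> /interp_betaE[F [_]]; rewrite lamE.
move=> lA; apply: (@interp_betaI fset0); last by rewrite lamE.
exact: fset0_sub_interp.
Qed.

(** By hypothesis, both sides evaluate [D] with [y] set to the current value of [x]. That value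
    survives the update of [y], and the update itself is overwritten. *)
Lemma interp_update_indep x y D G sigma : x <> y ->
  interp_equiv (App (Lam y D) (Var x)) D ->
  interp D (update G y sigma) = interp D sigma.
Proof.
move=> xy Dy; rewrite -[LHS]Dy -[RHS]Dy !interp_beta_var update_same.
by rewrite /update; case: eqP.
Qed.

Lemma interp_equiv_beta5 x y A D : x <> y ->
  interp_equiv (App (Lam y D) (Var x)) D ->
  interp_equiv (App (Lam x (Lam y A)) D) (Lam y (App (Lam x A) D)).
Proof.
move=> xy Dy sigma; apply/seteqP; split=> l.
  move=> /interp_betaE[F [FD [[G [m [mA ->]]]|->]]]; last by right.
  left; exists G, m; split=> //; apply: (@interp_betaI F).
    by rewrite (interp_update_indep _ _ xy Dy).
  by rewrite update_swap.
move=> [[G [m [/interp_betaE[F [FD mA]] ->]]]|->].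
  apply: (@interp_betaI F); first by rewrite (interp_update_indep _ _ xy Dy) in FD.
  by left; exists G, m; rewrite -update_swap.
(* The remaining element [atom y] belongs to the inner abstraction in every environment. *)
by apply: (@interp_betaI fset0); [exact: fset0_sub_interp|right].
Qed.

End Interpretation.

Theorem theorem9p7 (V : choiceType) (V_infinite : infinite_set [set: V]) :
  prelambda_congruence (@interp_equiv V).
Proof.
split.
- exact: interp_equiv_congruence.
- exact: interp_equiv_beta1.
- exact: interp_equiv_beta2.
- exact: interp_equiv_beta3.
- exact: interp_equiv_beta4.
- exact: interp_equiv_beta5.
Qed.
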